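(* Let $A$ be an order that is a Dedekind domain. Then the universal grading of $A$ is by a finite cyclic group; that is, if $(\Gamma,\mathbf{B})$ is the universal grading of $A$, then $\Gamma$ is a finite cyclic group.
   Context: All rings are commutative with identity. An order is a commutative ring $A$ whose additive group is isomorphic to $\mathbb{Z}^n$ for some integer $n\ge 0$. Let $\Gamma$ be a multiplicatively written abelian group. A $\Gamma$-grading of a ring $A$ is a system $\mathbf{B}=(B_\gamma)_{\gamma\in\Gamma}$ of additive subgroups $B_\gamma\subset A$ such that $B_\gamma\cdot B_{\gamma'}\subset B_{\gamma\gamma'}$ for all $\gamma,\gamma'\in\Gamma$, and such that the map $\bigoplus_{\gamma\in\Gamma}B_\gamma\to A$, $(x_\gamma)_\gamma\mapsto\sum_\gamma x_\gamma$, is bijective. If $f:\Gamma\to\Delta$ is a homomorphism of abelian groups, then $f_*\mathbf{B}$ denotes the $\Delta$-grading $(\sum_{\gamma\in f^{-1}(\delta)}B_\gamma)_{\delta\in\Delta}$ of $A$. A universal grading of $A$ is a pair $(\Gamma,\mathbf{B})$ consisting of an abelian group $\Gamma$ and a $\Gamma$-grading $\mathbf{B}$ of $A$ such that for each abelian group $\Delta$ and each $\Delta$-grading $\mathbf{C}$ of $A$ there is a unique group homomorphism $f:\Gamma\to\Delta$ with $\mathbf{C}=f_*\mathbf{B}$. Every reduced order (an order with no non-zero nilpotent elements; in particular any order that is a domain) has a universal grading, and it is unique up to a unique isomorphism. *)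

(* Defs.v *)
From HB Require Import structures.
From mathcomp Require Import all_boot all_order all_algebra.
From mathcomp Require Import finmap.
From mathcomp Require Import all_classical.

Set Implicit Arguments.
Unset Strict Implicit.
Unset Printing Implicit Defensive.

Import GRing.Theory.

Local Open Scope classical_set_scope.
Local Open Scope ring_scope.

Definition is_order (A : comPzRingType) : Prop :=
  exists (n : nat) (f : {additive A -> 'rV[int]_n}), bijective f.

(* Unlike the library's [idealr_closed], this allows the unit ideal. *)
Definition is_ideal (A : comNzRingType) (I : set A) : Prop :=
  I 0 /\ forall a x y, I x -> I y -> I (a * x + y).

Definition noetherian (A : comNzRingType) : Prop :=
  forall I : set A, is_ideal I ->
    exists (n : nat) (g : 'I_n -> A),
      I = [set x | exists c : 'I_n -> A, x = \sum_(i < n) c i * g i].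

Definition is_prime_ideal (A : comNzRingType) (P : set A) : Prop :=
  idealr_closed [in P] /\ prime_idealr_closed [in P].

(* [idealr_closed] includes properness. *)
Definition is_maximal_ideal (A : comNzRingType) (M : set A) : Prop :=
  idealr_closed [in M] /\
  forall J : set A, idealr_closed [in J] -> M `<=` J -> J = M.

Definition integrally_closed (A : idomainType) : Prop :=
  forall z : {fraction A},
    integralOver (@tofrac A) z -> exists a : A, z = tofrac a.

(* Fields are admitted; this is immaterial for orders, since no field has an
   additive group isomorphic to Z^n. *)
Definition is_dedekind (A : idomainType) : Prop :=
  [/\ noetherian A,
      integrally_closed A
    & forall P : set A, is_prime_ideal P -> P <> [set 0] ->
        is_maximal_ideal P].

(* Grading groups are [zmodType]s, hence written additively; they may be
   infinite.  The finitely supported functions [x] with [x g] in [B g] are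
   the elements of the direct sum of the [B g]. *)
Definition in_dsum (G : zmodType) (A : comPzRingType) (B : G -> set A)
    (x : {fsfun G -> A with 0}) : Prop :=
  forall g, B g (x g).

Definition fsfun_sum (G : zmodType) (A : comPzRingType)
    (x : {fsfun G -> A with 0}) : A :=
  \sum_(g <- finsupp x) x g.

Definition is_grading (G : zmodType) (A : comPzRingType) (B : G -> set A) :
    Prop :=
  [/\ forall g, zmod_closed [in B g],
      forall g h x y, B g x -> B h y -> B (g + h) (x * y)
    & forall a : A, exists! x : {fsfun G -> A with 0},
        in_dsum B x /\ fsfun_sum x = a].

Definition pushforward (G D : zmodType) (A : comPzRingType) (f : G -> D)
    (B : G -> set A) : D -> set A :=
  fun d => [set a | exists x : {fsfun G -> A with 0},
    [/\ in_dsum B x, forall g, g \in finsupp x -> f g = d & fsfun_sum x = a]].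

Definition is_universal_grading (G : zmodType) (A : comPzRingType)
    (B : G -> set A) : Prop :=
  is_grading B /\
  forall (D : zmodType) (C : D -> set A), is_grading C ->
    exists f : {additive G -> D},
      C = pushforward f B /\
      forall f' : {additive G -> D}, C = pushforward f' B -> f' =1 f.

Definition is_finite_cyclic (G : zmodType) : Prop :=
  finite_set [set: G] /\ exists g : G, forall x : G, exists k : int, x = g *~ k.

(* Main.v *)
(* Replacing G by the support of B, which is finite because A is finitely
   generated, we may assume that G is finite and every B_g is nonzero. It then
   suffices that G/pG has at most p elements for each prime p. Let
   R = sum of the B_g with g in pG, so that A is the direct sum over G/pG of
   nonzero R-modules. Modulo p the Frobenius sends sum a_g to sum a_g^p, so
   a^p lies in R + pA for every a in A. Let M be a maximal ideal of A over p
   and q its intersection with R. As the residue field A/M is finite, hence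
   perfect, R surjects onto it; and a^p is in qA for every a in M. Since M is
   locally generated by one element t and A = R + M, the powers
   1, t, ..., t^(p-1) span A/qA over R/q. On the other hand each of the |G/pG|
   summands of A is nonzero modulo q by Nakayama, whence |G/pG| <= p. *)

Require Import Defs.
From HB Require Import structures.
From mathcomp Require Import all_boot all_order all_algebra.
From mathcomp Require Import generic_quotient ring_quotient finmap.
From mathcomp Require Import all_classical.

Set Implicit Arguments.
Unset Strict Implicit.
Unset Printing Implicit Defensive.

Import Order.TTheory GRing.Theory Num.Theory.

Local Open Scope ring_scope.

(** * Residue fields *)

Section ResidueField.
Local Open Scope quotient_scope.

Variables (A : comNzRingType) (I : idealr A).
Hypothesis invI : forall a, a \notin I -> exists b, a * b - 1 \in I.

Let Q := {ideal_quot I}.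

Let piE a b : (\pi_Q a == \pi_Q b) = (a - b \in I).
Proof. by rewrite Quotient.idealrBE. Qed.

Let pi0 a : (\pi_Q a == 0) = (a \in I).
Proof. by have := piE a 0; rewrite subr0 raddf0. Qed.

(** The clause for 0 records the convention that 0 is its own inverse, so that choice yields a total
    inverse. *)
Let invQ_ex (x : Q) : exists y : Q, (x != 0 -> y * x = 1) /\ (x = 0 -> y = 0).
Proof.
elim/quotW: x => a; case: (boolP (a \in I)) => aI.
  by exists 0; rewrite pi0 aI.
have [b abI] := invI aI.
exists (\pi_Q b); split => [_|/eqP]; last by rewrite pi0 (negPf aI).
by apply/eqP; rewrite mulrC -rmorphM -(rmorph1 \pi_Q) piE.
Qed.

Let invQ x := sval (cid (invQ_ex x)).

Let invQP x : x != 0 -> invQ x * x = 1.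
Proof. exact: (svalP (cid (invQ_ex x))).1. Qed.

Let invQ0 : invQ 0 = 0.
Proof. exact: (svalP (cid (invQ_ex 0))).2. Qed.

#[local] HB.instance Definition _ :=
  GRing.ComNzRing_isField.Build {ideal_quot I} invQP invQ0.

Lemma residue_field_quot :
  exists (F : fieldType) (phi : {rmorphism A -> F}),
    (forall a, (phi a == 0) = (a \in I)) /\ (forall z, exists a, phi a = z).
Proof.
exists {ideal_quot I}, \pi_Q; split=> [a|z]; last first.
  by elim/quotW: z => a; exists a.
exact: pi0.
Qed.

End ResidueField.

(** The ideal aA + M contains both [M] and [a]; were it proper, maximality would put [a] in [M]. So
    it contains 1. *)
Lemma maximal_inv (A : comNzRingType) (M : set A) : is_maximal_ideal M ->
  forall a, ~ M a -> exists b, M (a * b - 1).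
Proof.
move=> [[M0 M1 MD] Mmax] a Ma.
have MM x y : M x -> M y -> forall c, M (c * x + y).
  by move=> Mx My c; have := MD c x y; rewrite !inE => /(_ Mx My).
have {}M0 : M 0 by rewrite inE in M0.
pose J : set A := [set x | exists c m, M m /\ x = a * c + m]%classic.
have JM x : M x -> J x by move=> Mx; exists 0, x; rewrite mulr0 add0r.
have [J1|J1] := pselect (J 1).
  have [c [m [Mm e]]] := J1; exists c.
  rewrite [X in _ - X]e opprD addrA subrr add0r -[- m]addr0 -mulN1r.
  by apply: MM.
exfalso; apply: Ma; suff <- : J = M by exists 1, 0; rewrite mulr1 addr0.
apply: Mmax => //; split; first by rewrite inE; exact: JM.
  by apply/negP; rewrite inE.
move=> d x y; rewrite !inE => -[c [m [Mm ->]]] [c' [m' [Mm' ->]]].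
exists (d * c + c'), (d * m + m'); split; first exact: MM.
by rewrite !mulrDr mulrCA addrACA.
Qed.

Lemma residue_field (A : comNzRingType) (M : set A) : is_maximal_ideal M ->
  exists (F : fieldType) (phi : {rmorphism A -> F}),
    (forall a, phi a = 0 <-> M a) /\ (forall z, exists a, phi a = z).
Proof.
move=> Mmax; have Minv := maximal_inv Mmax; have [hM _] := Mmax.
pose I : idealr A := HB.pack [in M] (isIdealr.Build A [in M] hM).
have [|F [phi [phi0 phiS]]] := @residue_field_quot A I.
  move=> a aI; have [|b Mb] := Minv a; last by exists b; rewrite inE.
  by move=> Ma; case/negP: aI; rewrite inE.
exists F, phi; split=> // a; split => [/eqP|Ma]; first by rewrite phi0 inE.
by apply/eqP; rewrite phi0 inE.
Qed.

(** * Local uniformizers in Dedekind orders *)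

Lemma order_span (A : comPzRingType) : is_order A ->
  exists (n : nat) (e : 'I_n -> A),
    forall a, exists z : 'I_n -> int, a = \sum_i e i *~ z i.
Proof.
move=> [n [f [g gK fK]]]; exists n, (fun i => g (delta_mx 0 i)) => a.
exists (fun i => f a 0 i); apply: (can_inj gK); rewrite raddf_sum /=.
rewrite [LHS]row_sum_delta; apply: eq_bigr => i _.
by rewrite raddfMz fK -scaler_int intz.
Qed.

Lemma order_char0 (A : comNzRingType) (p : nat) :
  is_order A -> (0 < p)%N -> p%:R != 0 :> A.
Proof.
move=> [n [f fbij]] p_gt0; apply/eqP => p0.
have := oner_neq0 A; apply/negP/negPn/eqP/(bij_inj fbij).
rewrite raddf0; apply/rowP => i; rewrite mxE.
have := congr1 (fun a => f a 0 i) p0.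
rewrite /= raddfMn raddf0 mulmxnE !mxE => /eqP.
by rewrite mulrn_eq0 (gtn_eqF p_gt0) => /eqP.
Qed.

Lemma order_nondivisible (A : comNzRingType) (p : nat) :
  is_order A -> (1 < p)%N -> exists b : A, ~ exists c, b = p%:R * c.
Proof.
move=> [n [f fbij]] p_gt1; case: n => [|n] in f fbij *.
  have := oner_neq0 A; suff -> : 1 = 0 :> A by rewrite eqxx.
  by apply: (bij_inj fbij); apply/rowP => -[].
have [g gK fK] := fbij; exists (g (delta_mx 0 0)) => -[c].
move=> /(congr1 (fun a => f a 0 0)) /=.
rewrite fK mulr_natl raddfMn mulmxnE !mxE /=.
move=> /(congr1 absz).
rewrite -(mulr_natr (f c 0 0)) abszM !natz !absz_nat => /eqP.
by rewrite eq_sym muln_eq1 => /andP[_ /eqP p1]; rewrite p1 in p_gt1.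
Qed.

(** Coordinates are reduced modulo p; the finite set of representatives stands in for the quotient
    A/pA. *)
Lemma order_finite_mod (A : comPzRingType) (p : nat) :
  is_order A -> (0 < p)%N ->
  exists (T : finType) (r : T -> A), forall a, exists x c, a = r x + p%:R * c.
Proof.
move=> /order_span[n [e eS]]; case: p => // p _.
pose T : finType := {ffun 'I_n -> 'I_p.+1}.
exists T, (fun x : T => \sum_i e i *+ x i) => a.
have [z ->] := eS a.
exists [ffun i => inord `|(z i %% p.+1)%Z|%N], (\sum_i e i *~ (z i %/ p.+1)%Z).
rewrite mulr_sumr -big_split /=; apply: eq_bigr => i _; rewrite ffunE inordK.
  rewrite {1}(divz_eq (z i) p.+1) mulrzDr addrC; congr (_ + _).
    by rewrite mulr_natl mulrzA pmulrn.
  by rewrite -{1}(gez0_abs (modz_ge0 (z i) _)) ?pmulrn.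
rewrite -ltz_nat gez0_abs ?modz_ge0 //; exact: ltz_mod.
Qed.

Section ColonIdeal.
Variables (A : idomainType) (p : nat).
Hypotheses (hA : is_order A) (p_gt1 : (1 < p)%N).

Let p_gt0 : (0 < p)%N. Proof. exact: ltnW. Qed.

(** The ideal (pA : b), that is, the annihilator of the class of [b] in A/pA. *)
Definition colon (b : A) : set A :=
  [set x | exists c, b * x = p%:R * c]%classic.

(** Take [b] outside pA for which (pA : b) contains the most representatives modulo p. Since p lies
    in these ideals, the representatives determine them, and (pA : b) cannot grow to a larger (pA :
    yb) with yb outside pA. *)
Lemma colon_maximal_exists : exists b : A,
  (~ exists c, b = p%:R * c) /\
  forall y x, ~ colon b y -> colon (y * b) x -> colon b x.
Proof.
have [T [r rP]] := order_finite_mod hA p_gt0.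
pose K b := [set x : T | `[< colon b (r x) >]].
pose P k := `[< exists b, (~ exists c, b = p%:R * c) /\ #|K b| = k >].
have exP : exists k, P k.
  have [b hb] := order_nondivisible hA p_gt1.
  by exists #|K b|; apply/asboolP; exists b.
have leP k : P k -> (k <= #|T|)%N by move=> /asboolP[b [_ <-]]; exact: max_card.
have [k /asboolP[b [bp bk]] kmax] := ex_maxnP exP leP.
exists b; split=> // y x yM.
have subK : K b \subset K (y * b).
  apply/fintype.subsetP => t; rewrite !inE => -[c hc]; exists (y * c).
  by rewrite -mulrA hc mulrCA.
have /eqP eqK : K b == K (y * b).
  rewrite eqEcard subK bk kmax //; apply/asboolP; exists (y * b); split=> //.
  by rewrite mulrC.
have [t [c ->]] := rP x => -[d hd].
have : t \in K (y * b).
  rewrite !inE; exists (d - y * b * c).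
  by rewrite mulrBr -hd mulrDr mulrCA addrK.
rewrite -eqK !inE => -[d' hd']; exists (d' + b * c).
by rewrite mulrDr hd' mulrCA -mulrDr.
Qed.

(** If xy lies in (pA : b) and y does not, then x lies in (pA : yb), which is no larger than (pA :
    b). So this ideal is prime; it contains p, hence is nonzero, hence maximal. *)
Lemma colon_maximal : is_dedekind A ->
  exists b, (~ exists c, b = p%:R * c) /\ is_maximal_ideal (colon b).
Proof.
move=> [_ _ dim1]; have [b [bp bmax]] := colon_maximal_exists.
exists b; split=> //; apply: dim1; last first.
  move=> /(congr1 (fun X => X p%:R)) /= e.
  have : colon b p%:R by exists b; rewrite mulrC.
  by rewrite e => /eqP; rewrite (negPf (order_char0 hA p_gt0)).
split; first split.
- by rewrite inE; exists 0; rewrite !mulr0.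
- by apply/negP; rewrite inE => -[c]; rewrite mulr1 => hc; apply: bp; exists c.
- move=> a x y; rewrite !inE => -[c hc] [d hd]; exists (a * c + d).
  by rewrite !mulrDr hd mulrCA hc mulrCA.
move=> x y; rewrite !inE => -[c hc].
have [?|yM] := pselect (colon b y); first by apply/orP; right; rewrite inE.
apply/orP; left; rewrite inE; apply: bmax yM _; exists c.
by rewrite -hc mulrAC mulrC [y * x]mulrC.
Qed.

(* [b / p] is not integral over [A], so by the determinant trick it cannot
   stabilise the finitely generated ideal [(pA : b)]. *)
Lemma colon_uniformizer b : is_dedekind A -> (~ exists c, b = p%:R * c) ->
  exists t u, [/\ colon b t, ~ colon b u
    & forall m, colon b m -> exists c, u * m = t * c].
Proof.
move=> [noeth intcl _] bp.
have p_neq0 : p%:R != 0 :> A by exact: order_char0.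
have [/existsNP[t /not_implyP[tM tN]]|stab] := pselect
    (~ forall m, colon b m -> exists u, colon b u /\ b * m = p%:R * u).
  (* Here u = bt/p lies outside the ideal, and um = t(bm/p) with bm/p in [A] for every [m] in the
     ideal. *)
  have [u hu] := tM; exists t, u; split=> //.
    by move=> uM; apply: tN; exists u.
  move=> m [c hc]; exists c; apply: (mulfI p_neq0).
  by rewrite mulrA -hu mulrAC hc mulrAC mulrA.
exfalso; move: stab => /contrapT stab.
have idealM : is_ideal (colon b).
  split=> [|a x y [c hc] [d hd]]; first by exists 0; rewrite !mulr0.
  by exists (a * c + d); rewrite !mulrDr hd mulrCA hc mulrCA.
have [n [g gM]] := noeth _ idealM.
have ginM i : colon b (g i).
  rewrite gM; exists (fun j => (j == i)%:R).
  rewrite (bigD1 i) //= eqxx mul1r big1 ?addr0 // => j /negPf ->.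
  by rewrite mul0r.
have exN i : exists c : 'I_n -> A, b * g i = p%:R * \sum_j c j * g j.
  have [u [uM ->]] := stab _ (ginM i).
  by move: uM; rewrite gM => -[c ->]; exists c.
have [N hN] := choice exN.
pose F := {fraction A}.
pose Nm : 'M[A]_n := \matrix_(j, i) N i j.
pose z : F := tofrac b / tofrac p%:R.
have zE : tofrac p%:R * z = tofrac b by rewrite mulrC mulfVK ?tofrac_eq0.
(* The row of generators is an eigenvector of [Nm] for z = b/p, nonzero because p is in the ideal;
   so z is a root of the monic characteristic polynomial. *)
have zint : integralOver (@tofrac A) z.
  exists (char_poly Nm); first exact: char_poly_monic.
  rewrite map_char_poly -[root _ _]/(root _ z) -eigenvalue_root_char.
  apply/eigenvalueP; exists (\row_j tofrac (g j)).
    apply/rowP => i; rewrite !mxE.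
    apply: (mulfI (x := tofrac p%:R)); first by rewrite tofrac_eq0.
    rewrite mulrA zE -rmorphM hN rmorphM rmorph_sum /=.
    by congr (_ * _); apply: eq_bigr => j _; rewrite !mxE rmorphM mulrC.
  apply/eqP => g0; have : colon b p%:R by exists b; rewrite mulrC.
  rewrite gM => -[c]; rewrite big1 => [/eqP|i _].
    by rewrite (negPf p_neq0).
  have /eqP := congr1 (fun v : 'rV_n => v 0 i) g0.
  by rewrite !mxE tofrac_eq0 => /eqP ->; rewrite mulr0.
have [a ha] := intcl _ zint; apply: bp; exists a.
apply/eqP; by rewrite -tofrac_eq rmorphM /= -ha zE.
Qed.

End ColonIdeal.

(** * The Frobenius map *)

Lemma exprD_prime (A : comNzRingType) (p : nat) (x y : A) : prime p ->
  exists c, (x + y) ^+ p = x ^+ p + y ^+ p + p%:R * c.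
Proof.
case: p => // p pr; pose f i := x ^+ (p.+1 - i) * y ^+ i.
exists (\sum_(i < p) f i.+1 *+ ('C(p.+1, i.+1) %/ p.+1)).
rewrite exprDn big_ord_recl big_ord_recr /= /bump /= subn0 subnn !expr0.
rewrite !mulr1 !mul1r bin0 add1n binn !mulr1n addrCA [LHS]addrC.
congr (_ + _); rewrite mulr_sumr; apply: eq_bigr => i _.
rewrite add1n mulr_natl -mulrnA divnK //.
by apply: prime_dvd_bin => //=; rewrite ltnS ltn_ord.
Qed.

Lemma expr_sum_prime (A : comNzRingType) (I : Type) (s : seq I) (f : I -> A)
    (p : nat) : prime p ->
  exists c, (\sum_(i <- s) f i) ^+ p = \sum_(i <- s) f i ^+ p + p%:R * c.
Proof.
move=> pr; elim: s => [|i s [c IH]].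
  by exists 0; rewrite !big_nil expr0n gtn_eqF ?prime_gt0 // mulr0 addr0.
have [d hd] := exprD_prime (f i) (\sum_(j <- s) f j) pr.
by exists (c + d); rewrite !big_cons hd IH mulrDr !addrA.
Qed.

(** By finiteness the p^i-th and p^j-th powers of z agree for some i < j. Frobenius being injective,
    z equals its own p^(j-i)-th power, so its p^(j-i-1)-th power is a p-th root of z. *)
Lemma finite_field_pth_root (F : fieldType) (T : finType) (r : T -> F)
    (p : nat) :
  (forall z, exists x, r x = z) -> p \in [pchar F] ->
  forall z : F, exists y, y ^+ p = z.
Proof.
move=> rS charF z; have [x xE] := choice (fun i => rS (z ^+ (p ^ i))).
have p_inj k (a b : F) : a ^+ (p ^ k) = b ^+ (p ^ k) -> a = b.
  elim: k a b => [|k IH] a b //; rewrite expnS !exprM => /IH/eqP.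
  rewrite -subr_eq0 -!(pFrobenius_autE charF) -pFrobenius_autB_comm;
    last exact: mulrC.
  by rewrite pFrobenius_autE expf_eq0 subr_eq0 => /andP[_ /eqP].
have [i [j [ltij eij]]] : exists i j, (i < j)%N /\ x i = x j.
  have : ~~ injectiveb (fun i : 'I_#|T|.+1 => x i).
    apply/negP => /injectiveP/leq_card; by rewrite card_ord ltnn.
  case/injectivePn => i [j neij eij].
  have [lt|lt|e] := ltngtP i j; [by exists i, j|by exists j, i|].
  by rewrite (val_inj e) eqxx in neij.
exists (z ^+ (p ^ (j - i).-1)); apply: (p_inj i).
rewrite -[RHS]xE eij xE -!exprM -expnS -expnD addnS -addSn prednK ?subn_gt0 //.
by rewrite subnK // ltnW.
Qed.

(** * Counting direct summands *)

Section Summands.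
Variables (A : idomainType) (p : nat) (R : subringClosed A).
Hypotheses (hA : is_order A) (p_pr : prime p).
Hypothesis RF : forall a, exists r c, r \in R /\ a ^+ p = r + p%:R * c.

Section Local.
Variables (F : fieldType) (phi : {rmorphism A -> F}) (t u : A).
Hypotheses (phiS : forall z, exists a, phi a = z) (phip : phi p%:R = 0).
Hypotheses (phit : phi t = 0) (phiu : phi u != 0).
Hypothesis tP : forall m, phi m = 0 -> exists c, u * m = t * c.
Variables (n : nat) (e : 'I_n -> A).
Hypothesis eS : forall a, exists z : 'I_n -> int, a = \sum_i e i *~ z i.

(* The extension [(R :&: ker phi) A] of the contracted maximal ideal; it
   suffices to take coefficients on additive generators [e] of [A]. *)
Definition ext_ideal (x : A) : Prop :=
  exists d : 'I_n -> A, (forall i, d i \in R /\ phi (d i) = 0) /\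
    x = \sum_i d i * e i.

Lemma ext_ideal_add x y : ext_ideal x -> ext_ideal y -> ext_ideal (x + y).
Proof.
move=> [d [hd ->]] [d' [hd' ->]]; exists (fun i => d i + d' i); split=> [i|].
  have [Rd fd] := hd i; have [Rd' fd'] := hd' i.
  by rewrite rpredD // rmorphD fd fd' addr0.
by rewrite -big_split; apply: eq_bigr => i _; rewrite mulrDl.
Qed.

Lemma ext_ideal0 : ext_ideal 0.
Proof.
exists (fun=> 0); split=> [i|]; first by rewrite rpred0 rmorph0.
by rewrite big1 // => i _; rewrite mul0r.
Qed.

Lemma ext_ideal_sum (I : finType) (f : I -> A) :
  (forall i, ext_ideal (f i)) -> ext_ideal (\sum_i f i).
Proof.
move=> hf; apply: (big_ind ext_ideal) => //; first exact: ext_ideal0.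
exact: ext_ideal_add.
Qed.

Lemma ext_ideal_mem r x : r \in R -> phi r = 0 -> ext_ideal (r * x).
Proof.
move=> Rr fr; have [z ->] := eS x; exists (fun i => r *~ z i); split=> [i|].
  by rewrite rpredMz // rmorphMz fr mul0rz.
by rewrite mulr_sumr; apply: eq_bigr => i _; rewrite mulrzAl mulrzAr.
Qed.

Lemma ext_ideal_mul a x : ext_ideal x -> ext_ideal (a * x).
Proof.
move=> [d [hd ->]]; rewrite mulr_sumr; apply: ext_ideal_sum => i.
by rewrite mulrCA; apply: ext_ideal_mem; case: (hd i).
Qed.

(** As [phi] kills p, the residue field is finite and every element has a p-th root y. If a lifts y,
    then a^p is congruent modulo p to an element of [R], which maps to z. *)
Lemma phiR z : exists r, r \in R /\ phi r = z.
Proof.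
have [T [r rP]] := order_finite_mod hA (prime_gt0 p_pr).
have charF : p \in [pchar F] by rewrite inE p_pr -(rmorph_nat phi) phip /=.
have [y] : exists y, y ^+ p = z.
  apply: finite_field_pth_root (phi \o r) p _ charF z => w.
  have [a <-] := phiS w; have [x [c ->]] := rP a; exists x.
  by rewrite /= rmorphD rmorphM phip mul0r addr0.
have [a <-] := phiS y => <-; have [s [c [Rs hs]]] := RF a; exists s; split=> //.
by rewrite -rmorphXn hs rmorphD rmorphM phip mul0r addr0.
Qed.

(** In a^p = r + pc both r and p lie in [R] and are killed by [phi]. *)
Lemma ext_ideal_expr a : phi a = 0 -> ext_ideal (a ^+ p).
Proof.
move=> fa; have [r [c [Rr hr]]] := RF a; rewrite hr.
have Rp : p%:R \in R by rewrite rpred_nat.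
apply: ext_ideal_add; last exact: ext_ideal_mem.
rewrite -[r]mulr1; apply: ext_ideal_mem => //.
have := congr1 phi hr; rewrite rmorphXn fa expr0n gtn_eqF ?prime_gt0 //.
by rewrite rmorphD rmorphM phip mul0r addr0.
Qed.

(** The element [u] is invertible modulo [ext_ideal]: if v inverts it modulo the kernel of [phi],
    then k = 1 - uv has k^p in [ext_ideal], and the geometric sum turns v into an inverse w. Then m
    is congruent to wum = twc. *)
Lemma uniformizer_mod m : phi m = 0 -> exists c, ext_ideal (m - t * c).
Proof.
have [v fv] := phiS (phi u)^-1 => fm.
pose k := 1 - u * v; pose w := v * \sum_(i < p) k ^+ i.
have fk : phi k = 0 by rewrite rmorphB rmorphM fv rmorph1 mulfV // subrr.
have uw : 1 - u * w = k ^+ p.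
  have k1 : k - 1 = - (u * v) by rewrite /k addrAC subrr sub0r.
  have <- : k ^+ p - 1 = - (u * w) by rewrite subrX1 k1 mulNr /w mulrA.
  by rewrite addrC subrK.
have [c hc] := tP fm; exists (w * c).
rewrite mulrCA -hc mulrCA mulrA -[X in X - _]mul1r -mulrBl mulrC.
by apply: ext_ideal_mul; rewrite uw; exact: ext_ideal_expr.
Qed.

(** A t-adic expansion: the residue of the remainder [a'] lifts to a digit in [R], and what is left
    is again a multiple of [t] modulo [ext_ideal]. *)
Lemma span_mod k a : exists (c : 'I_k -> A) a',
  (forall i, c i \in R) /\ ext_ideal (a - \sum_i c i * t ^+ i - t ^+ k * a').
Proof.
elim: k => [|k [c [a' [Rc hc]]]].
  exists (fun=> 0), a; split=> [[]//|].
  by rewrite big_ord0 subr0 mul1r subrr; exact: ext_ideal0.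
have [r [Rr fr]] := phiR (phi a').
have [|b hb] := @uniformizer_mod (a' - r); first by rewrite rmorphB fr subrr.
exists (fun i => if unlift ord_max i is Some j then c j else r), b; split.
  by move=> i; case: unliftP.
rewrite big_ord_recr /= unlift_none.
rewrite (eq_bigr (fun i : 'I_k => c i * t ^+ i)) => [|i _]; last first.
  suff -> : widen_ord (leqnSn k) i = lift ord_max i by rewrite liftK.
  by apply: val_inj; rewrite /= /bump leqNgt ltn_ord.
have := ext_ideal_add hc (ext_ideal_mul (t ^+ k) hb).
rewrite exprSr; congr ext_ideal; rewrite !mulrBr !opprD [r * _]mulrC.
rewrite -!addrA; congr (_ + _); rewrite ?mulrA; congr (_ + _).
by rewrite addKr.
Qed.

(** After p digits the remainder is a multiple of t^p, which lies in [ext_ideal]. *)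
Lemma span_mod_expr a : exists c : 'I_p -> A,
  (forall i, c i \in R) /\ ext_ideal (a - \sum_i c i * t ^+ i).
Proof.
have [c [a' [Rc hc]]] := span_mod p a; exists c; split=> //.
rewrite -[X in ext_ideal X](subrK (t ^+ p * a')); apply: ext_ideal_add => //.
by rewrite mulrC; apply: ext_ideal_mul; exact: ext_ideal_expr.
Qed.

(** Nakayama by determinants. If f(A) lay in [ext_ideal], applying f to f(e_i) = sum_j d_ij e_j
    would show that 1 - d kills the vector of the f(e_i). Its determinant is 1 modulo the kernel of
    [phi], so nonzero in a domain, and f would vanish. *)
Lemma summand_not_ext (f : {additive A -> A}) :
  (forall r a, r \in R -> f (r * a) = r * f a) ->
  (forall a, f (f a) = f a) -> (exists a, f a != 0) ->
  exists a, ~ ext_ideal (f a).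
Proof.
move=> fR ff [a fa]; apply/existsNP => fext.
have [d hd] := choice (fun i => fext (e i)).
pose D : 'M[A]_n := 1%:M - \matrix_(i, j) d i j.
have De : D *m (\col_i f (e i)) = 0.
  apply/colP => i; rewrite mulmxBl mul1mx !mxE; apply/eqP; rewrite subr_eq0.
  apply/eqP; rewrite -[LHS]ff; have [hd1 ->] := hd i.
  rewrite raddf_sum; apply: eq_bigr => j _.
  by rewrite !mxE fR //; case: (hd1 j).
have detD : phi (\det D) = 1.
  rewrite -det_map_mx map_mxB map_mx1 (_ : map_mx _ _ = 0) ?subr0 ?det1 //.
  by apply/matrixP => i j; rewrite !mxE; case: (hd i) => /(_ j)[].
have detD0 : \det D != 0.
  by apply: contraTneq (oner_neq0 F) => D0; rewrite -detD D0 rmorph0 eqxx.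
case/negP: fa; have [z ->] := eS a; rewrite raddf_sum big1 // => i _.
have := congr1 (mulmx (\adj D)) De.
rewrite mulmxA mul_adj_mx mulmx0 mul_scalar_mx => /colP/(_ i).
rewrite !mxE => /eqP; rewrite mulf_eq0 (negPf detD0) => /eqP.
by rewrite raddfMz => ->; rewrite mul0rz.
Qed.

(* [R / (R :&: ker phi)] and [A / ker phi] are the same field, over which
   [A / ext_ideal] has dimension at most [p] since it is spanned by the powers
   of [t]; every summand contributes a nonzero vector to it. *)
Lemma local_summands_le m (f : 'I_m -> {additive A -> A}) :
  (forall j r a, r \in R -> f j (r * a) = r * f j a) ->
  (forall i j a, f i (f j a) = if i == j then f j a else 0) ->
  (forall j, exists a, f j a != 0) -> (m <= p)%N.
Proof.
move=> fR forth fnz; rewrite leqNgt; apply/negP => lt_pm.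
have fidem j a : f j (f j a) = f j a by rewrite forth eqxx.
have [x hx] := choice (fun j => summand_not_ext (fR j) (fidem j) (fnz j)).
have [c hc] := choice (fun j => span_mod_expr (f j (x j))).
(* Row j holds the residues of the coordinates of f_j(x_j) on the powers of [t]; having more than p
   rows, [C] has a nonzero left kernel vector [v], which is then lifted to [R]. *)
pose C : 'M[F]_(m, p) := \matrix_(j, i) phi (c j i).
have : kermx C != 0.
  by rewrite kermx_eq0 /row_free ltn_eqF // (leq_ltn_trans (rank_leq_col C)).
case/rowV0Pn => v /sub_kermxP vC /rV0Pn[l vl].
have [d hd] := choice (fun j => phiR (v 0 j)).
have dy : ext_ideal (\sum_j d j * f j (x j)).
  have -> : \sum_j d j * f j (x j) =
      \sum_j d j * (f j (x j) - \sum_i c j i * t ^+ i) +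
      \sum_i (\sum_j d j * c j i) * t ^+ i.
    under [X in _ + X]eq_bigr do rewrite mulr_suml.
    rewrite [X in _ + X]exchange_big -big_split; apply: eq_bigr => j _ /=.
    rewrite [X in _ + X](_ : _ = d j * \sum_i c j i * t ^+ i).
      by rewrite -mulrDr subrK.
    by rewrite mulr_sumr; apply: eq_bigr => i _; rewrite mulrA.
  apply: ext_ideal_add.
    by apply: ext_ideal_sum => j; apply: ext_ideal_mul; case: (hc j).
  apply: ext_ideal_sum => i; apply: ext_ideal_mem.
    by apply: rpred_sum => j _; rewrite rpredM //; [case: (hd j)|case: (hc j)].
  rewrite rmorph_sum; have := congr1 (fun v : 'rV_p => v 0 i) vC.
  rewrite !mxE => vC0; rewrite -[RHS]vC0; apply: eq_bigr => j _.
  by rewrite !mxE rmorphM; case: (hd j) => _ ->.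
(* Being [R]-linear, [f l] preserves [ext_ideal]; by orthogonality it isolates the l-th term of the
   relation. *)
have dl : ext_ideal (d l * f l (x l)).
  have : ext_ideal (f l (\sum_j d j * f j (x j))).
    have [q [hq ->]] := dy; rewrite raddf_sum; apply: ext_ideal_sum => i.
    have [Rq fq] := hq i.
    by rewrite fR //; exact: ext_ideal_mem.
  congr ext_ideal; rewrite raddf_sum (bigD1 l) //= fR; last by case: (hd l).
  rewrite forth eqxx big1 ?addr0 // => j jl; rewrite fR; last by case: (hd j).
  by rewrite forth eq_sym (negPf jl) mulr0.
(* An element [w] of [R] inverse to [d l] modulo the kernel of [phi] removes the coefficient. *)
have [Rd fd] := hd l; have [w [Rw fw]] := phiR (v 0 l)^-1.
apply: (hx l); rewrite -[X in ext_ideal X](subrK (w * d l * f l (x l))).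
apply: ext_ideal_add; last by rewrite -mulrA; exact: ext_ideal_mul.
rewrite -[X in X - _]mul1r -mulrBl; apply: ext_ideal_mem.
  by rewrite rpredB ?rpred1 ?rpredM.
by rewrite rmorphB rmorph1 rmorphM fw fd mulVf // subrr.
Qed.

End Local.

Lemma summands_le m (f : 'I_m -> {additive A -> A}) : is_dedekind A ->
  (forall j r a, r \in R -> f j (r * a) = r * f j a) ->
  (forall i j a, f i (f j a) = if i == j then f j a else 0) ->
  (forall j, exists a, f j a != 0) -> (m <= p)%N.
Proof.
move=> hD; have p_gt1 := prime_gt1 p_pr.
have [b [bp Mmax]] := colon_maximal hA p_gt1 hD.
have [t [u [Mt Mu tu]]] := colon_uniformizer hA p_gt1 hD bp.
have [F [phi [phi0 phiS]]] := residue_field Mmax.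
have [n [e eS]] := order_span hA.
apply: (@local_summands_le F phi t u phiS _ _ _ _ n e eS) => [|||k /phi0/tu//].
- by apply/phi0; exists b; rewrite mulrC.
- exact/phi0.
- by apply/eqP => /phi0.
Qed.

End Summands.

(** * Homogeneous components *)

Lemma fsfun_sumE (G : zmodType) (A : comPzRingType) (x : {fsfun G -> A with 0})
    (s : seq G) : uniq s -> {subset finsupp x <= s} ->
  fsfun_sum x = \sum_(g <- s) x g.
Proof.
move=> us sub; rewrite /fsfun_sum [RHS](bigID (mem (finsupp x))) /=.
rewrite [X in _ + X]big1 ?addr0 => [|g gx]; last exact: fsfun_dflt.
rewrite -[RHS]big_filter; apply: perm_big; apply: uniq_perm => //.
  exact: fset_uniq.
  exact: filter_uniq.
by move=> g; rewrite mem_filter; case: (boolP (g \in finsupp x)) => // /sub ->.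
Qed.

Section Component.
Variables (G : zmodType) (A : comNzRingType) (B : G -> set A).
Hypothesis hB : is_grading B.

Definition component (g : G) (a : A) : A :=
  (let: And3 _ _ ex := hB in sval (cid (ex a))) g.

Let dec_ex a : exists x : {fsfun G -> A with 0},
  [/\ in_dsum B x, fsfun_sum x = a, (forall g, component g a = x g) &
   forall y : {fsfun G -> A with 0}, in_dsum B y -> fsfun_sum y = a -> x = y].
Proof.
rewrite /component; case: hB => _ _ ex; case: cid => x /= [[xB xa] xu].
by exists x; split=> // y yB ya; apply: xu.
Qed.

Lemma homogeneous_sub g x y : B g x -> B g y -> B g (x - y).
Proof.
by case: hB => /(_ g)[_ BB] _ _; have := BB x y; rewrite !inE.
Qed.

Lemma homogeneous0 g : B g 0.
Proof. by case: hB => /(_ g)[+ _] _ _; rewrite inE. Qed.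

Lemma homogeneousM g h x y : B g x -> B h y -> B (g + h) (x * y).
Proof. by case: hB => _ + _; apply. Qed.

Lemma homogeneousD g x y : B g x -> B g y -> B g (x + y).
Proof.
move=> Bx By; rewrite -[y]opprK; apply: homogeneous_sub => //.
by rewrite -sub0r; apply: homogeneous_sub => //; exact: homogeneous0.
Qed.

Lemma component_homogeneous g a : B g (component g a).
Proof. by have [x [xB _ -> _]] := dec_ex a; exact: xB. Qed.

Lemma component_unique (s : seq G) (f : G -> A) a : uniq s ->
  (forall g, B g (f g)) -> (forall g, g \notin s -> f g = 0) ->
  a = \sum_(g <- s) f g -> forall g, component g a = f g.
Proof.
move=> us fB f0 af g; have [x [_ _ -> xu]] := dec_ex a.
pose y : {fsfun G -> A with 0} := [fsfun g in [fset h in s]%fset => f g].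
have yE h : y h = f h.
  rewrite fsfun_fun in_fset /=; case: ifPn => // hs; by rewrite f0.
rewrite (xu y) ?yE // => [h|]; first by rewrite yE.
rewrite (fsfun_sumE us) => [|h]; first by rewrite af; apply: eq_bigr.
by rewrite mem_finsupp yE; apply: contraR => /f0 ->.
Qed.

Lemma component_sum a : exists s, [/\ uniq s,
  forall g, g \notin s -> component g a = 0 & a = \sum_(g <- s) component g a].
Proof.
have [x [_ xa xE _]] := dec_ex a; exists (finsupp x); split.
- exact: fset_uniq.
- by move=> g gx; rewrite xE fsfun_dflt.
- by rewrite -[LHS]xa; apply: eq_bigr => g _; rewrite xE.
Qed.

Lemma component_sum_sub (s : seq G) a : uniq s ->
  (forall g, g \notin s -> component g a = 0) ->
  a = \sum_(g <- s) component g a.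
Proof.
move=> us s0; have [x [_ xa xE _]] := dec_ex a.
rewrite -[LHS]xa (fsfun_sumE us) => [|g]; first by apply: eq_bigr.
by rewrite mem_finsupp -xE; apply: contraR => /s0 ->.
Qed.

Lemma component_is_zmod_morphism g : zmod_morphism (component g).
Proof.
move=> a b; have [s [us s0 _]] := component_sum a.
have [s' [us' s0' _]] := component_sum b.
apply: (@component_unique (undup (s ++ s'))
  (fun h => component h a - component h b)).
- exact: undup_uniq.
- by move=> h; apply: homogeneous_sub; exact: component_homogeneous.
- move=> h; rewrite mem_undup mem_cat negb_or => /andP[/s0 -> /s0' ->].
  by rewrite subrr.
- rewrite sumrB.
  congr (_ - _); apply: component_sum_sub; rewrite ?undup_uniq //.
    by move=> h; rewrite mem_undup mem_cat negb_or => /andP[/s0].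
  by move=> h; rewrite mem_undup mem_cat negb_or => /andP[_ /s0'].
Qed.

HB.instance Definition _ g := GRing.isZmodMorphism.Build A A (component g)
  (component_is_zmod_morphism g).

Lemma component_homog g h a :
  B h a -> component g a = if g == h then a else 0.
Proof.
move=> Ba; apply: (@component_unique [:: h] (fun g => if g == h then a else 0)).
- by [].
- by move=> k; case: eqP => [->//|_]; exact: homogeneous0.
- by move=> k; rewrite inE => /negPf ->.
- by rewrite big_seq1 eqxx.
Qed.

Lemma component_inj a b : (forall g, component g a = component g b) -> a = b.
Proof.
move=> ab; have [s [us s0 ->]] := component_sum a.
rewrite [RHS](component_sum_sub us) => [|g /s0]; first by apply: eq_bigr.
by rewrite ab.
Qed.

(** Multiplication by [x] translates the decomposition of [a] by [h]. *)
Lemma component_homogeneousM h k x a : B h x ->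
  component k (x * a) = x * component (k - h) a.
Proof.
move=> Bx; have [s [us s0 as_]] := component_sum a.
apply: (@component_unique (map (+%R h) s) (fun k => x * component (k - h) a)).
- by rewrite map_inj_uniq //; exact: addrI.
- move=> g; rewrite -{1}(subrK h g) addrC; apply: homogeneousM => //.
  exact: component_homogeneous.
- move=> g gs; rewrite s0 ?mulr0 //; apply: contra gs => gs.
  by apply/mapP; exists (g - h); rewrite // addrC subrK.
- rewrite big_map {1}as_ mulr_sumr; apply: eq_bigr => g _.
  by rewrite addrAC subrr add0r.
Qed.

(** Comparing parts of degree h in x * 1 = x, for x homogeneous of degree h, shows that the
    degree-zero part of 1 fixes x. By additivity it fixes all of [A], so it is 1. *)
Lemma homogeneous1 : B 0 1.
Proof.
suff <- : component 0 1 = 1 by exact: component_homogeneous.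
have key h x : B h x -> x * component 0 1 = x.
  move=> Bx; rewrite -{1}(subrr h) -component_homogeneousM // mulr1.
  by rewrite (component_homog _ Bx) eqxx.
have keyS a : a * component 0 1 = a.
  have [s [_ _ ->]] := component_sum a.
  rewrite mulr_suml; apply: eq_bigr => g _.
  by apply: (key g); exact: component_homogeneous.
by rewrite -[LHS]mul1r keyS.
Qed.

Lemma homogeneousX g x n : B g x -> B (g *+ n) (x ^+ n).
Proof.
move=> Bx; elim: n => [|n IH]; first exact: homogeneous1.
by rewrite mulrS exprS; exact: homogeneousM.
Qed.

Lemma pushforwardP (D : zmodType) (f : G -> D) d a :
  pushforward f B d a <-> forall g, component g a != 0 -> f g = d.
Proof.
have [x [xB xa xE xu]] := dec_ex a; split=> [[y [yB yf ya]] g|af].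
  by rewrite xE (xu y yB ya) => yg; apply: yf; rewrite mem_finsupp.
by exists x; split=> // g; rewrite mem_finsupp -xE => /af.
Qed.

Lemma pushforward_id d a : pushforward id B d a <-> B d a.
Proof.
split=> [/pushforwardP ad|Ba]; last first.
  apply/pushforwardP => g; rewrite (component_homog _ Ba).
  by case: (g =P d) => [->|_] //; rewrite eqxx.
have [s [_ _ ->]] := component_sum a.
apply: (big_ind (B d)) => [||g _]; [exact: homogeneous0|exact: homogeneousD|].
have [->|/ad <-] := eqVneq (component g a) 0; first exact: homogeneous0.
exact: component_homogeneous.
Qed.

Definition support : set G := [set g | exists x, B g x /\ x != 0]%classic.

Lemma component_support g a : component g a != 0 -> support g.
Proof. by exists (component g a); split=> //; exact: component_homogeneous. Qed.

(** A nonzero homogeneous element is an integer combination of the additive generators, so its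
    degree occurs in one of them. *)
Lemma support_finite : is_order A ->
  exists s : seq G, uniq s /\ forall g, g \in s <-> support g.
Proof.
move=> /order_span[n [e eS]].
have [s sP] := choice (fun i => component_sum (e i)).
pose s' := undup (flatten (codom s)).
exists [seq g <- s' | `[< support g >]]; split.
  by rewrite filter_uniq // undup_uniq.
move=> g; rewrite mem_filter; split=> [/andP[/asboolP]//|gS].
apply/andP; split; first exact/asboolP.
have [x [Bx]] := gS; apply: contra_neqT.
rewrite mem_undup => gs; have [z xz] := eS x.
have := component_homog g Bx; rewrite eqxx => <-.
rewrite xz raddf_sum big1 // => i _.
have [_ /(_ g) ei0 _] := sP i; rewrite /= raddfMz /= ei0 ?mul0rz //.
apply: contra gs => gs; apply/flattenP; exists (s i) => //; exact: codom_f.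
Qed.

End Component.

(** * Cosets of pG *)

Section MultiplePart.
Variables (G : zmodType) (A : comNzRingType) (B : G -> set A).
Hypothesis hB : is_grading B.

Definition multiple (p : nat) (g : G) : bool := `[< exists y, g = y *+ p >].

Lemma multiple_zmod_closed p : zmod_closed (multiple p).
Proof.
split; first by apply/asboolP; exists 0; rewrite mul0rn.
move=> g h /asboolP[x ->] /asboolP[y ->]; apply/asboolP.
by exists (x - y); rewrite mulrnBl.
Qed.

HB.instance Definition _ p := GRing.isZmodClosed.Build G (multiple p)
  (multiple_zmod_closed p).

(** The subring given by the direct sum of the B_g with g in pG, over which the coset summands are
    modules. *)
Definition multiple_part (p : nat) (a : A) : bool :=
  `[< forall g, g \notin multiple p -> component hB g a = 0 >].

Lemma multiple_part_subring_closed p : subring_closed (multiple_part p).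
Proof.
split.
- apply/asboolP => g gp; rewrite (component_homog hB _ (homogeneous1 hB)).
  by case: eqP gp => // ->; rewrite rpred0.
- move=> a b /asboolP ha /asboolP hb; apply/asboolP => g gp.
  by rewrite raddfB /= ha // hb // subrr.
- move=> a b /asboolP ha /asboolP hb; apply/asboolP => g gp.
  have [s [_ _ ->]] := component_sum hB a.
  rewrite mulr_suml raddf_sum big1 // => h _.
  case: (boolP (h \in multiple p)) => hp; last by rewrite ha // mul0r raddf0.
  rewrite /= (component_homogeneousM hB _ _ (component_homogeneous hB h a)).
  rewrite hb ?mulr0 //; apply: contra gp => ghp.
  by rewrite -(subrK h g) rpredD.
Qed.

HB.instance Definition _ p := GRing.isSubringClosed.Build A (multiple_part p)
  (multiple_part_subring_closed p).

(** Modulo p the power a^p is the sum of the p-th powers of the components, and the p-th power of a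
    component of degree g has degree pg. *)
Lemma multiple_part_expr p a : prime p ->
  exists r c, r \in multiple_part p /\ a ^+ p = r + p%:R * c.
Proof.
move=> pr; have [s [_ _ as_]] := component_sum hB a.
have [c hc] := expr_sum_prime s (fun g => component hB g a) pr.
exists (\sum_(g <- s) component hB g a ^+ p), c.
rewrite -hc -as_; split=> //.
apply: rpred_sum => g _; apply/asboolP => h hp.
have Bg := homogeneousX hB p (component_homogeneous hB g a).
rewrite (component_homog hB _ Bg).
case: eqP hp => // -> /negP; case; apply/asboolP; by exists g.
Qed.

End MultiplePart.

Section CosetProjection.
Variables (G : zmodType) (A : comNzRingType) (B : G -> set A).
Hypothesis hB : is_grading B.
Variable s : seq G.
Hypotheses (us : uniq s) (sS : forall g, g \in s <-> support B g).

Lemma component_out g a : g \notin s -> component hB g a = 0.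
Proof. by apply: contraNeq => /component_support/sS. Qed.

Lemma component_sum_support a : a = \sum_(g <- s) component hB g a.
Proof. by apply: component_sum_sub => // g; exact: component_out. Qed.

Lemma componentM k a b :
  component hB k (a * b) =
  \sum_(g <- s) component hB g a * component hB (k - g) b.
Proof.
rewrite {1}(component_sum_support a) mulr_suml raddf_sum /=.
apply: eq_bigr => g _; apply: component_homogeneousM.
exact: component_homogeneous.
Qed.

Definition projection (Q : pred G) (a : A) :=
  \sum_(g <- s | Q g) component hB g a.

Lemma projection_is_zmod_morphism Q : zmod_morphism (projection Q).
Proof.
by move=> a b; rewrite -sumrB; apply: eq_bigr => g _; rewrite raddfB.
Qed.

HB.instance Definition _ Q := GRing.isZmodMorphism.Build A A (projection Q)
  (projection_is_zmod_morphism Q).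

Lemma component_projection Q k a :
  component hB k (projection Q a) = if Q k then component hB k a else 0.
Proof.
rewrite /projection big_mkcond.
pose f k := if Q k then component hB k a else 0.
apply: (component_unique hB us (f := f)); rewrite /f.
- move=> g; case: ifP => _; first exact: component_homogeneous.
  exact: (homogeneous0 hB).
- by move=> g gs; rewrite component_out // if_same.
- by [].
Qed.

(** All degrees occurring in [r] lie in pG, so multiplication by [r] preserves each coset of pG. *)
Lemma projection_linear p c r a : r \in multiple_part hB p ->
  projection (fun g => g - c \in multiple p) (r * a) =
  r * projection (fun g => g - c \in multiple p) a.
Proof.
move=> /asboolP rP; apply: (@component_inj _ _ _ hB) => k.
rewrite component_projection !componentM.
rewrite (_ : (if _ then _ else _) = \sum_(g <- s)
   if k - c \in multiple p
   then component hB g r * component hB (k - g) a else 0).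
  apply: eq_bigr => g _; rewrite component_projection.
  have [gp|gp] := boolP (g \in multiple p).
    by rewrite [k - g - c]addrAC (rpredBr _ gp); case: ifP; rewrite ?mulr0.
  by rewrite rP // !mul0r if_same.
by case: ifP => // _; rewrite big1.
Qed.

End CosetProjection.

(** The bound |G/pG| <= p in pigeonhole form, without the quotient group. If the cosets of the c_i
    were distinct, their projections would be p + 1 nonzero orthogonal idempotents, linear over the
    part in pG. *)
Lemma graded_dedekind_cosets (A : idomainType) (G : zmodType) (B : G -> set A)
    (p : nat) (c : 'I_p.+1 -> G) :
  is_order A -> is_dedekind A -> is_grading B -> prime p ->
  (forall g, support B g) ->
  exists i j : 'I_p.+1, (i < j)%N /\ exists y, c j - c i = y *+ p.
Proof.
move=> hA hD hB pr full; apply: contrapT => nc.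
have [s [us sS]] := support_finite hB hA.
have Qij i j k : k - c i \in multiple p -> k - c j \in multiple p -> i = j.
  move=> ki kj; apply: contrapT => /eqP; rewrite neq_ltn => ij; apply: nc.
  case/orP: ij => ij.
    exists i, j; split=> //; have := rpredB ki kj.
    by rewrite opprB addrC addrA subrK => /asboolP.
  exists j, i; split=> //; have := rpredB kj ki.
  by rewrite opprB addrC addrA subrK => /asboolP.
pose f j : {additive A -> A} :=
  projection hB s (fun g => g - c j \in multiple p).
have /negP[] : ~~ (p < p)%N by rewrite ltnn.
apply: (summands_le hA pr (fun a => multiple_part_expr hB a pr) (f := f) hD).
- by move=> j r a rR; exact: projection_linear.
- move=> i j a; apply: (@component_inj _ _ _ hB) => k.
  rewrite !component_projection //; case: eqP => [<-|ij].
    by rewrite /f component_projection //; case: (k - c i \in _).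
  rewrite raddf0; case: ifP => // ki; case: ifP => // kj.
  by case: ij; exact: Qij ki kj.
- move=> j; have [x [Bx x0]] := full (c j); exists x.
  apply: contraNneq x0 => fx0; have := component_projection hB us sS
    (fun g => g - c j \in multiple p) (c j) x.
  rewrite -/(f j x) fx0 raddf0 subrr rpred0 (component_homog hB _ Bx) eqxx.
  move=> ->.
  exact: eqxx.
Qed.

(** * Universal gradings *)

Section SubZmodule.
Variables (G : zmodType) (S : zmodClosed G).

#[local] HB.instance Definition _ :=
  [SubChoice_isSubZmodule of {x : G | x \in S} by <:].

Lemma zmod_closed_embedding : exists (H : zmodType) (i : {additive H -> G}),
  injective i /\ forall g, g \in S <-> exists h, i h = g.
Proof.
exists {x : G | x \in S}, val; split; first exact: val_inj.
move=> g; split=> [gS|[h <-]]; last exact: valP.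
by exists (exist _ g gS).
Qed.

End SubZmodule.

(** Two of the multiples 0, g, ..., (size s)g coincide. The bound on [n] ensures that it divides the
    factorial of [size s]. *)
Lemma finite_mulrn_eq0 (G : zmodType) (s : seq G) (g : G) :
  (forall n, g *+ n \in s) -> exists2 n, (0 < n <= size s)%N & g *+ n = 0.
Proof.
move=> gs; have : ~~ injectiveb (fun i : 'I_(size s).+1 => g *+ i).
  apply/negP => /injectiveP inj.
  have /uniq_leq_size : uniq (codom (fun i : 'I_(size s).+1 => g *+ i)).
    by apply/injectiveP.
  have sub : {subset codom (fun i : 'I_(size s).+1 => g *+ i) <= s}.
    by move=> _ /codomP[i ->].
  by move=> /(_ s sub); rewrite size_codom card_ord ltnn.
case/injectivePn => i [j].
wlog lt_ij : i j / (i < j)%N => [IH|_ e].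
  rewrite neq_ltn => /orP[] ij e; [apply: (IH i j)|apply: (IH j i)] => //;
  by rewrite neq_ltn ij ?orbT.
exists (j - i)%N; last by rewrite mulrnBr ?(ltnW lt_ij) // e subrr.
by rewrite subn_gt0 lt_ij (leq_trans (leq_subr _ _)) // -ltnS.
Qed.

Section Universal.
Variables (G : zmodType) (A : idomainType) (B : G -> set A).
Hypotheses (hA : is_order A) (hB : is_universal_grading B).

Let gB : is_grading B. Proof. by case: hB. Qed.

Let S (g : G) : bool := `[< support B g >].

Let S0 : S 0.
Proof.
by apply/asboolP; exists 1; split; [exact: homogeneous1|exact: oner_neq0].
Qed.

(** In a domain the product of nonzero homogeneous elements is nonzero. *)
Let SD g h : S g -> S h -> S (g + h).
Proof.
move=> /asboolP[x [Bx x0]] /asboolP[y [By y0]]; apply/asboolP.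
by exists (x * y); split; [exact: homogeneousM|rewrite mulf_neq0].
Qed.

(* A finite submonoid of a group is closed under opposites. *)
Let S_zmod_closed : zmod_closed S.
Proof.
split=> // g h Sg Sh; apply: SD => //; have [s [_ sS]] := support_finite gB hA.
have Shn n : S (h *+ n) by elim: n => // n IH; rewrite mulrS; exact: SD.
have [|[|n] // _ hn] := @finite_mulrn_eq0 G s h.
  by move=> n; apply/sS/asboolP; exact: Shn.
suff -> : - h = h *+ n by [].
by apply/eqP; rewrite eq_sym -addr_eq0 -mulrSr hn.
Qed.

(** Every degree with a nonzero piece lies in the image of [i], so decompositions over [G] and over
    [H] correspond along [i]. *)
Lemma restricted_grading (H : zmodType) (i : {additive H -> G}) :
  injective i -> (forall g, g \in S <-> exists h, i h = g) ->
  is_grading (fun h => B (i h)).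
Proof.
move=> iinj iS; have [s [us sS]] := support_finite gB hA.
have inv_ex g : exists h, g \in S -> i h = g.
  have [/iS[h hg]|_] := boolP (g \in S); [by exists h|by exists 0].
have [inv invE] := choice inv_ex.
have inS h : i h \in S by apply/iS; exists h.
have invK h : inv (i h) = h by apply: iinj; exact: invE.
split.
- by move=> h; case: gB => /(_ (i h)).
- by move=> g h x y Bx By; rewrite raddfD; exact: homogeneousM.
move=> a; pose t := [fset inv g | g in s]%fset.
pose x : {fsfun H -> A with 0} := [fsfun h in t => component gB (i h) a].
have xE h : x h = component gB (i h) a.
  rewrite fsfun_fun; case: ifPn => // ht; apply/esym; apply: contraNeq ht.
  move=> /component_support/sS hs; apply/imfsetP; exists (i h) => //=.
have uinv : uniq (map inv s).
  rewrite map_inj_in_uniq // => g g' /sS gs /sS gs' e.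
  by rewrite -(invE g) ?e ?invE //; exact/asboolP.
exists x; split=> [|y [yB ya]].
  split; first by move=> h; rewrite xE; exact: component_homogeneous.
  rewrite (fsfun_sumE uinv).
    rewrite big_map [RHS](component_sum_support gB us sS).
    rewrite big_seq [RHS]big_seq; apply: eq_bigr => g /sS gs.
    by rewrite xE invE //; apply/asboolP.
  move=> h; rewrite mem_finsupp xE => /component_support/sS hs.
  by rewrite -(invK h); apply: map_f.
apply/fsfunP => h; rewrite xE.
rewrite (@component_unique _ _ _ gB (map i (finsupp y))
  (fun g => if g \in S then y (inv g) else 0) a).
- by rewrite inS invK.
- by rewrite map_inj_uniq ?fset_uniq.
- move=> g; case: ifP => [gS|_]; last exact: homogeneous0.
  by rewrite -{1}(invE g gS); exact: yB.
- move=> g gy; case: ifP => // gS; apply: fsfun_dflt; apply: contra gy => gy.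
  by apply/mapP; exists (inv g); rewrite ?invE.
- rewrite big_map -[LHS]ya; apply: eq_bigr => k _.
  by rewrite inS invK.
Qed.

(* [B] factors through a grading by its support [S], viewed as a group; by
   uniqueness the composite [G -> S -> G] is the identity. *)
Lemma universal_support g : support B g.
Proof.
pose SZ : zmodClosed G :=
  HB.pack S (GRing.isZmodClosed.Build G S S_zmod_closed).
have [H [i [iinj iS]]] := zmod_closed_embedding SZ.
have [_ univ] := hB.
have [f [fC _]] := univ _ _ (restricted_grading iinj iS).
have [f0 [_ f0u]] := univ _ _ gB.
have idB : B = pushforward idfun B.
  apply/funext => d; apply/funext => a; apply/propext.
  by split=> /(pushforward_id gB).
have ifB : B = pushforward (i \o f) B.
  apply/funext => d; apply/funext => a; apply/propext.
  (* In a degree i(h) the claim is the one for [f] in degree h, as [i] is injective. Outside [S]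
     both sides are zero, because [i \o f] takes values in [S]. *)
  have [/iS[h <-]|dS] := boolP (d \in S).
    have := congr1 (fun C => C h a) fC => /= ->.
    split=> /(pushforwardP gB) P; apply/(pushforwardP gB) => k /P.
      by move=> /= ->.
    by move=> /= /iinj.
  split=> [Ba|/(pushforwardP gB) P].
    apply/(pushforwardP gB) => k; rewrite (component_homog gB _ Ba).
    case: (k =P d) => [_ a0|_]; last by rewrite eqxx.
    by case/negP: dS; apply/asboolP; exists a.
  suff -> : a = 0 by exact: homogeneous0.
  apply: (@component_inj _ _ _ gB) => k; rewrite raddf0; apply: contraNeq dS.
  by move=> /P <-; apply/iS; exists (f k).
have e : g = i (f g) by rewrite -[LHS]/(idfun g) (f0u _ idB) -(f0u _ ifB).
by have /asboolP : g \in S by apply/iS; exists (f g).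
Qed.

End Universal.

(** * Abelian groups that are cyclic modulo every prime *)

(** Apply the hypothesis to 0, h, ..., (p-1)h, x with h outside pG. Two multiples of h in the list
    cannot agree modulo pG, since p is prime to their difference and Bezout would put h in pG; so x
    agrees with one of them. *)
Lemma cyclic_mod_exists (G : zmodType) (p : nat) : prime p ->
  (forall c : 'I_p.+1 -> G, exists i j : 'I_p.+1, (i < j)%N /\
     exists y, c j - c i = y *+ p) ->
  exists h : G, forall x, exists (k : int) y, x = h *~ k + y *+ p.
Proof.
move=> pr hc; have [all|/existsNP[h hp]] :=
  pselect (forall x : G, exists y, x = y *+ p).
  by exists 0 => x; have [y ->] := all x; exists 0, y; rewrite mulr0z add0r.
exists h => x; pose c (i : 'I_p.+1) := if (i < p)%N then h *+ i else x.
have [i [j [ij [y]]]] := hc c; rewrite /c (leq_trans ij) -1?ltnS //.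
case: ifP => jp e; last first.
  by exists i, y; rewrite -e -pmulrn addrC subrK.
exfalso; apply: hp; rewrite -mulrnBr ?(ltnW ij) // in e.
have cop : coprime p (j - i).
  rewrite prime_coprime // gtnNdvd ?subn_gt0 //.
  exact: leq_ltn_trans (leq_subr _ _) _.
have /coprimezP[[u v] /= uv] : coprimez p%:Z (j - i)%:Z by [].
exists (h *~ u + y *~ v).
rewrite -[LHS]mulr1z -uv mulrzDr mulrzA mulrnDl pmulrn; congr (_ + _).
by rewrite mulrC mulrzA -pmulrn e !pmulrn mulrzAC.
Qed.

(** Induction with n = mp, p prime: an element generating [G] both modulo m and modulo p generates
    it modulo mp. If p divides m, a generator modulo m will do; otherwise the Chinese remainder
    theorem combines generators modulo m and modulo p. *)
Lemma cyclic_mod_pos (G : zmodType) (n : nat) : (0 < n)%N ->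
  (forall p, prime p ->
    exists h : G, forall x, exists (k : int) y, x = h *~ k + y *+ p) ->
  exists g : G, forall x, exists (k : int) y, x = g *~ k + y *+ n.
Proof.
move=> + hG; elim/ltn_ind: n => n IH n0.
have [n1|n1] := leqP n 1.
  have -> : n = 1%N by case: n n0 n1 {IH} => [|[]].
  by exists 0 => x; exists 0, x; rewrite mulr0z add0r.
pose p := pdiv n; have pr : prime p := pdiv_prime n1.
pose m := (n %/ p)%N; have nE : n = (m * p)%N by rewrite divnK // pdiv_dvd.
have m0 : (0 < m)%N by move: n0; rewrite nE muln_gt0 => /andP[].
have ltmn : (m < n)%N by rewrite nE ltn_Pmulr // prime_gt1.
have [g gP] := IH m ltmn m0.
suff [g' [gm gp]] : exists g' : G,
    (forall x, exists (k : int) y, x = g' *~ k + y *+ m) /\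
    (forall x, exists (k : int) y, x = g' *~ k + y *+ p).
  exists g' => x; have [k [y ->]] := gm x; have [k' [y' ->]] := gp y.
  exists (k + k' * m%:Z), y'.
  by rewrite mulrzDr mulrnDl mulrzA -pmulrn -addrA nE mulnC mulrnA.
have [/dvdnP[q mE]|ndvd] := boolP (p %| m)%N.
  exists g; split=> // x; have [k [y ->]] := gP x.
  by exists k, (y *+ q); rewrite mE mulrnA.
have [h hP] := hG p pr.
have cop : coprime p m by rewrite prime_coprime.
have /coprimezP[[u v] /= uv] : coprimez p%:Z m%:Z by [].
(* Congruent to g modulo m, and to h modulo p because up + vm = 1. *)
pose g' := g + (h - g) *~ v *+ m.
have gE : g = g' - (h - g) *~ v *+ m by rewrite addrK.
have hE : h = g' + (h - g) *~ u *+ p.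
  rewrite /g' !pmulrn -!mulrzA -addrA -mulrzDr addrC [_ + (u * _)]addrC uv.
  rewrite mulr1z.
  by rewrite addrC subrKC.
clearbody g'; exists g'; split=> x.
  have [k [y ->]] := gP x; exists k, (y - (h - g) *~ v *~ k).
  rewrite {1}gE mulrzBl mulrnBl -addrA; congr (_ + _).
  by rewrite addrC !pmulrn mulrzAC.
have [k [y ->]] := hP x; exists k, (y + (h - g) *~ u *~ k).
rewrite {1}hE mulrzDl mulrnDl -addrA; congr (_ + _).
by rewrite addrC !pmulrn mulrzAC.
Qed.

(** The factorial of [size s] kills [G], so a generator modulo that factorial generates [G]. *)
Lemma finite_cyclic_of_mod_prime (G : zmodType) (s : seq G) :
  (forall g, g \in s) ->
  (forall p, prime p ->
    exists h : G, forall x, exists (k : int) y, x = h *~ k + y *+ p) ->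
  is_finite_cyclic G.
Proof.
move=> sG hG; split.
  by apply/finite_seqP; exists s; apply/seteqP; split=> g _ /=; rewrite ?sG.
have [g gP] := cyclic_mod_pos (fact_gt0 (size s)) hG.
exists g => x; have [k [y ->]] := gP x; exists k.
have [n n_le ny] := finite_mulrn_eq0 (fun n => sG (y *+ n)).
have /dvdnP[q ->] : (n %| (size s)`!)%N by exact: dvdn_fact.
by rewrite mulnC mulrnA ny mul0rn addr0.
Qed.

Theorem theorem1p4 (A : idomainType) (hA : is_order A) (hD : is_dedekind A)
    (G : zmodType) (B : G -> set A) (hB : is_universal_grading B) :
  is_finite_cyclic G.
Proof.
have full := universal_support hA hB; have [gB _] := hB.
(* Every degree lies in the support, so the finite list of the support enumerates [G]. *)
have [s [_ sS]] := support_finite gB hA.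
apply: (@finite_cyclic_of_mod_prime G s) => [g|p pr]; first exact/sS.
by apply: cyclic_mod_exists => // c; exact: graded_dedekind_cosets gB _ _.
Qed.
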